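(* Let $U=\begin{pmatrix} A_{U} & B_{U}\\ C_{U} & D_{U}\end{pmatrix}$ and $V=\begin{pmatrix} A_{V} & B_{V}\\ C_{V} & D_{V}\end{pmatrix}$ be complex block matrices of the same size, partitioned in the same way, with $A_U,A_V\in\mathbb{C}^{m\times n}$, $B_U,B_V\in\mathbb{C}^{m\times p}$, $C_U,C_V\in\mathbb{C}^{s\times n}$, $D_U,D_V\in\mathbb{C}^{s\times p}$. Let $F_{U}=D_{U}-C_{U}A_{U}^\dagger B_{U}$ and $F_{V}=D_{V}-C_{V}A_{V}^\dagger B_{V}$. Suppose that $R(B_{U})\subseteq R(A_{U})$, $R((A_{U}^\dagger B_{U})^* )\subseteq R(F_{U}^* )$, $R(C_{V}^* )\subseteq R(A_{V}^* )$ and $R(C_{V}A_{V}^\dagger)\subseteq R(F_{V})$. If $(U,V)$ is a Moore-Penrose inverse absorbing pair, then $(F_{U},F_{V})$ is also a Moore-Penrose inverse absorbing pair.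
   Context: $R(X)$ denotes the range (column space) of a matrix $X$ and $X^*$ its conjugate transpose. $X^\dagger$ denotes the Moore-Penrose inverse of $X$, i.e. the unique matrix $Y$ with $XYX=X$, $YXY=Y$, $(XY)^*=XY$, $(YX)^*=YX$. For complex matrices $P,Q$ of the same size, the pair $(P,Q)$ is called a Moore-Penrose inverse absorbing pair if $P^\dagger+Q^\dagger=P^\dagger(P+Q)Q^\dagger$. *)

(* Defs.v *)
From mathcomp Require Import all_boot all_order all_algebra.
From mathcomp Require Import reals complex.

Set Implicit Arguments.
Unset Strict Implicit.
Unset Printing Implicit Defensive.

Import Order.TTheory GRing.Theory Num.Theory.
Local Open Scope ring_scope.
Local Open Scope sesquilinear_scope.

(* MathComp's subspace order compares row spaces, hence the transpositions;
   range_subP gives the unfolded meaning. *)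
Definition range_sub (C : numClosedFieldType) m n p
    (X : 'M[C]_(m, n)) (Y : 'M[C]_(m, p)) : bool :=
  (X^T <= Y^T)%MS.

Lemma range_subP (C : numClosedFieldType) m n p
    (X : 'M[C]_(m, n)) (Y : 'M[C]_(m, p)) :
  reflect (forall x : 'cV_n, exists y : 'cV_p, X *m x = Y *m y) (range_sub X Y).
Proof.
apply: (iffP idP) => [/submxP[D XD] x|H].
  exists (D^T *m x); apply: trmx_inj.
  by rewrite !trmx_mul trmxK XD mulmxA.
apply/row_subP => i; have [y Xy] := H (delta_mx i 0).
by rewrite rowE -trmx_delta -trmx_mul Xy trmx_mul submxMl.
Qed.

Definition is_mpinv (C : numClosedFieldType) m n
    (X : 'M[C]_(m, n)) (Y : 'M[C]_(n, m)) : bool :=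
  [&& X *m Y *m X == X, Y *m X *m Y == Y,
      (X *m Y)^t* == X *m Y & (Y *m X)^t* == Y *m X].

Section MoorePenrose.
Variable C : numClosedFieldType.

Lemma trmxC_mul m n p (A : 'M[C]_(m, n)) (B : 'M[C]_(n, p)) :
  (A *m B)^t* = B^t* *m A^t*.
Proof. by rewrite trmx_mul map_mxM. Qed.

Lemma mulmx_trmxC_eq0 m n (A : 'M[C]_(m, n)) : A *m A^t* = 0 -> A = 0.
Proof.
move=> A0; apply/matrixP => i j; rewrite mxE.
have := congr1 (fun M : 'M_m => M i i) A0; rewrite !mxE => /eqP.
rewrite psumr_eq0 => [/allP/(_ j)|k _]; last by rewrite !mxE mul_conjC_ge0.
by rewrite mem_index_enum !mxE mul_conjC_eq0 => /(_ isT)/eqP.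
Qed.

Lemma row_free_gram_unit m n (A : 'M[C]_(m, n)) :
  row_free A -> A *m A^t* \in unitmx.
Proof.
move=> Afree; rewrite -row_free_unit -kermx_eq0; apply/eqP.
set K := kermx _; apply: (row_free_inj Afree); rewrite mul0mx.
apply: mulmx_trmxC_eq0.
by rewrite trmxC_mul mulmxA -(mulmxA K) mulmx_ker mul0mx.
Qed.

Lemma trmxC_gram_inv m n (A : 'M[C]_(m, n)) :
  (invmx (A *m A^t*))^t* = invmx (A *m A^t*).
Proof. by rewrite trmx_inv map_invmx trmxC_mul trmxCK. Qed.

Lemma mpinv_exists m n (X : 'M[C]_(m, n)) : exists Y, is_mpinv X Y.
Proof.
suff H r (L : 'M[C]_(m, r)) (R : 'M[C]_(r, n)) :
    row_free (L^t*) -> row_free R -> exists Y, is_mpinv (L *m R) Y.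
  rewrite -(mulmx_base X); apply: H; last exact: row_base_free.
  by rewrite /row_free mxrank_map mxrank_tr; exact: col_base_full.
move=> Lfree Rfree.
pose N := L^t* *m (L^t*)^t*; pose M := R *m R^t*.
have Nunit : N \in unitmx by exact: row_free_gram_unit.
have Munit : M \in unitmx by exact: row_free_gram_unit.
have NE : L^t* *m L = N by rewrite /N trmxCK.
pose Y := R^t* *m invmx M *m invmx N *m L^t*.
have XYE : L *m R *m Y = L *m invmx N *m L^t*.
  rewrite /Y -!mulmxA; congr (_ *m _); rewrite [R *m _]mulmxA -/M.
  by rewrite mulKVmx.
have YXE : Y *m (L *m R) = R^t* *m invmx M *m R.
  rewrite /Y -!mulmxA; do 2!congr (_ *m _).
  by rewrite [L^t* *m _]mulmxA NE mulKmx.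
exists Y; apply/and4P; split; apply/eqP.
- rewrite XYE -!mulmxA; congr (_ *m _).
  by rewrite [L^t* *m _]mulmxA NE mulKmx.
- rewrite YXE /Y -!mulmxA; do 2!congr (_ *m _).
  by rewrite [R *m _]mulmxA -/M mulKVmx.
- by rewrite XYE !trmxC_mul trmxC_gram_inv trmxCK NE mulmxA.
- by rewrite YXE !trmxC_mul trmxC_gram_inv trmxCK mulmxA.
Qed.

Lemma mpinv_unique m n (X : 'M[C]_(m, n)) Y Z :
  is_mpinv X Y -> is_mpinv X Z -> Y = Z.
Proof.
case/and4P=> /eqP Y1 /eqP Y2 /eqP Y3 /eqP Y4.
case/and4P=> /eqP Z1 /eqP Z2 /eqP Z3 /eqP Z4.
have YZ : Y *m X = Z *m X.
  rewrite -Y4 -{1}Z1 [Y *m _]mulmxA mulmxA -[_ *m Z *m X]mulmxA.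
  by rewrite trmxC_mul Y4 Z4 -mulmxA [X *m _]mulmxA Y1.
have ZY : X *m Y = X *m Z.
  rewrite -Y3 -{1}Z1 -[_ *m X *m Y]mulmxA.
  by rewrite trmxC_mul Y3 Z3 mulmxA Y1.
by rewrite -Y2 YZ -mulmxA ZY mulmxA Z2.
Qed.

End MoorePenrose.

Definition mpinv (C : numClosedFieldType) m n (X : 'M[C]_(m, n)) : 'M[C]_(n, m) :=
  xchoose (mpinv_exists X).

Lemma mpinvP (C : numClosedFieldType) m n (X : 'M[C]_(m, n)) :
  is_mpinv X (mpinv X).
Proof. exact: xchooseP. Qed.

Definition mp_absorbing (C : numClosedFieldType) m n (P Q : 'M[C]_(m, n)) : Prop :=
  mpinv P + mpinv Q = mpinv P *m (P + Q) *m mpinv Q.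

(* Main.v *)
Require Import Defs.
From mathcomp Require Import all_boot all_order all_algebra.
From mathcomp Require Import reals complex.

(** [(P, Q)] is absorbing iff [P = Q X] and [Q = Y P] for some [X], [Y], that
    is, the columns of [P] lie in the column space of [Q] and the rows of [Q] in
    the row space of [P].  If [B_U = A_U A_U^+ B_U], then
    [U (-A_U^+ B_U; I) = (0; F_U)]; if [C_V = C_V A_V^+ A_V], then
    [(-C_V A_V^+, I) V = (0, F_V)].  Substituting [U = V X] in the former gives
    [F_U = F_V X'], and [V = Y U] in the latter gives [F_V = Y' F_U]. *)

Set Implicit Arguments.
Unset Strict Implicit.
Unset Printing Implicit Defensive.

Import GRing.Theory.
Local Open Scope ring_scope.
Local Open Scope sesquilinear_scope.
Local Open Scope complex_scope.

Section Absorbing.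
Variable C : numClosedFieldType.

Lemma range_sub_factor m n p (X : 'M[C]_(m, n)) (Y : 'M[C]_(m, p)) :
  range_sub X Y -> exists D, X = Y *m D.
Proof.
by case/submxP=> D XD; exists D^T; apply: trmx_inj; rewrite trmx_mul trmxK.
Qed.

Lemma range_sub_trmxC_factor m n p (X : 'M[C]_(n, m)) (Y : 'M[C]_(p, m)) :
  range_sub (X^t*) (Y^t*) -> exists D, X = D *m Y.
Proof.
case/range_sub_factor=> D XD; exists (D^t*).
by rewrite -[X]trmxCK XD trmxC_mul trmxCK.
Qed.

Section Penrose.
Variables (m n : nat) (X : 'M[C]_(m, n)).

Lemma mulmx_mpinvK : X *m mpinv X *m X = X.
Proof. by case/and4P: (mpinvP X) => /eqP. Qed.

Lemma mpinv_mulmxK : mpinv X *m X *m mpinv X = mpinv X.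
Proof. by case/and4P: (mpinvP X) => _ /eqP. Qed.

Lemma mulmx_mpinv_trmxC : (X *m mpinv X)^t* = X *m mpinv X.
Proof. by case/and4P: (mpinvP X) => _ _ /eqP. Qed.

Lemma mpinv_mulmx_trmxC : (mpinv X *m X)^t* = mpinv X *m X.
Proof. by case/and4P: (mpinvP X) => _ _ _ /eqP. Qed.

Lemma mpinv_trmxC : mpinv (X^t*) = (mpinv X)^t*.
Proof.
apply: mpinv_unique (mpinvP _) _; apply/and4P; split; apply/eqP.
- by rewrite -!trmxC_mul mulmxA mulmx_mpinvK.
- by rewrite -!trmxC_mul mulmxA mpinv_mulmxK.
- by rewrite -!trmxC_mul !mpinv_mulmx_trmxC.
- by rewrite -!trmxC_mul !mulmx_mpinv_trmxC.
Qed.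

End Penrose.

(** [P P^+] and [Q Q^+] are Hermitian projectors onto the column spaces, so taking adjoints turns
    [P P^+ Q Q^+ = P P^+] into [Q Q^+ P P^+ = P P^+], which says that [Q Q^+] fixes [P]. *)
Lemma mpinv_absorb_rangeP m n p (P : 'M[C]_(m, n)) (Q : 'M[C]_(m, p)) :
  mpinv P *m (Q *m mpinv Q) = mpinv P <-> exists X, P = Q *m X.
Proof.
split=> [PQ | [X PX]].
- exists (mpinv Q *m P); rewrite mulmxA.
  have PP : Q *m mpinv Q *m (P *m mpinv P) = P *m mpinv P.
    rewrite -[Q *m _]mulmx_mpinv_trmxC -[P *m _]mulmx_mpinv_trmxC -trmxC_mul.
    by rewrite -mulmxA PQ.
  by rewrite -{2}(mulmx_mpinvK P) mulmxA PP mulmx_mpinvK.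
have QP : Q *m mpinv Q *m P = P by rewrite PX mulmxA mulmx_mpinvK.
have PQ : P *m mpinv P *m (Q *m mpinv Q) = P *m mpinv P.
  rewrite -[Q *m mpinv Q]mulmx_mpinv_trmxC -[P *m _]mulmx_mpinv_trmxC.
  by rewrite -trmxC_mul mulmxA QP.
by rewrite -{1}(mpinv_mulmxK P) -!mulmxA [P *m _]mulmxA PQ mulmxA mpinv_mulmxK.
Qed.

(** The previous equivalence for [Q^t*] and [P^t*], read through the adjoint. *)
Lemma mpinv_absorb_corangeP m n p (P : 'M[C]_(n, m)) (Q : 'M[C]_(p, m)) :
  mpinv P *m P *m mpinv Q = mpinv Q <-> exists Y, Q = Y *m P.
Proof.
have QP := mpinv_absorb_rangeP (Q^t*) (P^t*).
rewrite !mpinv_trmxC -!trmxC_mul in QP.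
split=> [PQ | [Y QY]].
- have [|Y QY] := iffLR QP; first by rewrite PQ.
  by exists (Y^t*); rewrite -[Q]trmxCK QY trmxC_mul trmxCK.
rewrite -[LHS]trmxCK (iffRL QP) ?trmxCK //.
by exists (Y^t*); rewrite QY trmxC_mul.
Qed.

(** The product expands to [P^+ P Q^+ + P^+ Q Q^+]; the equation forces the first term to be [Q^+]
    and the second to be [P^+]. *)
Lemma mp_absorbingP m n (P Q : 'M[C]_(m, n)) :
  mp_absorbing P Q <->
  (exists X, P = Q *m X) /\ (exists Y, Q = Y *m P).
Proof.
rewrite -mpinv_absorb_rangeP -mpinv_absorb_corangeP /mp_absorbing.
rewrite mulmxDr mulmxDl -[mpinv P *m Q *m _]mulmxA.
split=> [PQ | [-> ->]]; last exact: addrC.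
(* Left multiplication by the projector [P^+ P] fixes [P^+] and [P^+ P Q^+],
   which isolates the first identity. *)
have PQP : mpinv P *m (Q *m mpinv Q) = mpinv P.
  have := congr1 (mulmx (mpinv P *m P)) PQ.
  by rewrite !mulmxDr !mulmxA !mpinv_mulmxK [LHS]addrC => /addrI.
by split=> //; apply: (addIr (mpinv P)); rewrite -{2}PQP -PQ addrC.
Qed.

(** Arbitrary factors [Y] and [W] stand in for [A_U^+ B_U] and [C_V A_V^+], which makes the
    statement stable under plain transposition. *)
Lemma schur_factor_range m n p s q (AU : 'M[C]_(m, n)) BU CU (DU : 'M_(s, p))
    (AV : 'M[C]_(m, q)) (BV : 'M_(m, p)) CV DV X Y W :
  block_mx AU BU CU DU = block_mx AV BV CV DV *m X ->
  BU = AU *m Y -> CV = W *m AV ->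
  exists Z, DU - CU *m Y = (DV - W *m BV) *m Z.
Proof.
move=> UV BE CE; pose K := X *m col_mx (- Y) 1%:M; exists (dsubmx K).
have : block_mx AV BV CV DV *m K = col_mx 0 (DU - CU *m Y).
  by rewrite mulmxA -UV mul_block_col !mulmxN !mulmx1 BE addNr addrC.
rewrite -{1}[K]vsubmxK mul_block_col => /eq_col_mx[top <-].
(* With [K = (K1; K2)], [top] says [A_V K1 = - B_V K2]; multiplying by [W] on the left turns
   [C_V K1] into [- W B_V K2]. *)
rewrite CE mulmxBl -!mulmxA.
by move/eqP: top; rewrite addr_eq0 => /eqP->; rewrite mulmxN addrC.
Qed.

(** Transpose of the previous lemma: [U] and [V] trade places, and so do [Y] and [W]. *)
Lemma schur_factor_corange m n p s r (AU : 'M[C]_(m, n)) BU CU (DU : 'M_(s, p))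
    (AV : 'M[C]_(r, n)) BV (CV : 'M_(s, n)) DV X Y W :
  block_mx AV BV CV DV = X *m block_mx AU BU CU DU ->
  BU = AU *m Y -> CV = W *m AV ->
  exists Z, DV - W *m BV = Z *m (DU - CU *m Y).
Proof.
move=> /(congr1 trmx); rewrite trmx_mul !tr_block_mx => VU.
move=> /(congr1 trmx) BE /(congr1 trmx) CE; rewrite !trmx_mul in BE CE.
have [K /(congr1 trmx) KE] := schur_factor_range VU CE BE; exists K^T.
by move: KE; rewrite -!trmx_mul -!linearB /= trmx_mul !trmxK.
Qed.

End Absorbing.

Theorem theorem4p2 (R : realType) (m n p s : nat)
    (AU AV : 'M[R[i]]_(m, n)) (BU BV : 'M[R[i]]_(m, p))
    (CU CV : 'M[R[i]]_(s, n)) (DU DV : 'M[R[i]]_(s, p)) :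
  let U := block_mx AU BU CU DU in
  let V := block_mx AV BV CV DV in
  let FU := DU - CU *m mpinv AU *m BU in
  let FV := DV - CV *m mpinv AV *m BV in
  range_sub BU AU ->
  range_sub ((mpinv AU *m BU)^t*) (FU^t*) ->
  range_sub (CV^t*) (AV^t*) ->
  range_sub (CV *m mpinv AV) FV ->
  mp_absorbing U V ->
  mp_absorbing FU FV.
Proof.
move=> U V FU FV /range_sub_factor[Y BE] _ /range_sub_trmxC_factor[W CE] _.
case/mp_absorbingP=> [[X UX] [Z VZ]]; apply/mp_absorbingP.
(* The factors given by the range inclusions are arbitrary; [A A^+ A = A] replaces them by the ones
   occurring in [FU] and [FV]. *)
have {Y}BE : BU = AU *m (mpinv AU *m BU) by rewrite BE !mulmxA mulmx_mpinvK.
have {W}CE : CV = CV *m mpinv AV *m AV.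
  by rewrite CE -!mulmxA [AV *m _]mulmxA mulmx_mpinvK.
split; first by rewrite /FU -mulmxA; exact: schur_factor_range UX BE CE.
by rewrite /FU -mulmxA; exact: schur_factor_corange VZ BE CE.
Qed.
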